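(* Let $\mathsf{GL}^\circ$ be the logic on cyclic formulas obtained from $\mathsf{CHL}$ by adding all instances of $\Box\phi\to\Box\Box\phi$ (closed under all the rules of $\mathsf{CHL}$), and let $\mathsf{GL}$ be ordinary Löb's logic on acyclic formulas. Then the map $\mathsf{js}$ carries an interpretation of $\mathsf{GL}^\circ$ in $\mathsf{GL}$ commuting with substitution, namely: (i) $\mathsf{js}(\phi)$ is an acyclic formula for every cyclic formula $\phi$; (ii) $\mathsf{js}(p)=p$ for every variable $p$, $\mathsf{GL}\vdash \mathsf{js}(\neg\phi)\leftrightarrow\neg\mathsf{js}(\phi)$, $\mathsf{GL}\vdash \mathsf{js}(\Box\phi)\leftrightarrow\Box\mathsf{js}(\phi)$, $\mathsf{GL}\vdash\mathsf{js}(\phi\circ\psi)\leftrightarrow(\mathsf{js}(\phi)\circ\mathsf{js}(\psi))$ for $\circ\in\{\wedge,\vee,\to\}$, and $\mathsf{js}(\top)=\top$, $\mathsf{js}(\bot)=\bot$; (iii) for every cyclic formula $\phi$ and substitution $\sigma=[q_0:\chi_0,\dots,q_{k-1}:\chi_{k-1}]$ by cyclic formulas, $\mathsf{GL}\vdash\mathsf{js}(\phi\sigma)\leftrightarrow\mathsf{js}(\phi)[q_0:\mathsf{js}(\chi_0),\dots,q_{k-1}:\mathsf{js}(\chi_{k-1})]$; (iv) if $\mathsf{GL}^\circ\vdash\phi$ then $\mathsf{GL}\vdash\mathsf{js}(\phi)$.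
   Context: Cyclic formulas. Labels: $\bot,\top$ and propositional variables $p_0,p_1,\dots$ (arity 0), $\neg,\Box$ (arity 1), $\wedge,\vee,\to$ (arity 2). A graph is $\langle V,r,S,\lambda\rangle$ with $V$ finite, root $r\in V$, $\lambda:V\to$ Labels, $S:V\to V^{*}$ with the length of $S(a)$ equal to the arity of $\lambda(a)$; $S_i(a)$ is the $i$-th entry of $S(a)$; write $a\hat S b$ if $b=S_i(a)$ for some $i$; every vertex is reachable from $r$ by a finite $\hat S$-path. A vertex labelled $\ell$ is an $\ell$-occurrence. A cycle is a set of pairwise distinct vertices $a_0,\dots,a_{k-1}$ with $a_0\hat S a_1\hat S\cdots\hat S a_{k-1}\hat S a_0$. A (cyclic) formula is a graph in which every cycle contains a $\Box$-occurrence; acyclic formulas are identified (modulo bisimilarity) with ordinary modal formulas. A bisimulation between graphs is a relation $R$ with: $aRa'$ implies $\lambda(a)=\lambda'(a')$ and $S_i(a)\,R\,S'_i(a')$ for all $i$; $\phi\simeq\psi$ means some bisimulation relates the roots. $\langle\phi\rangle_a$ is the subgraph generated by vertex $a$ (with root $a$). Operations $\neg\phi,\Box\phi,(\phi\wedge\psi),\dots$ take disjoint copies of the arguments and add a new root with the given label whose successors are their roots. Substitution $\phi[p_0:\psi_0,\dots]$: take the disjoint union of $\phi$ and the $\psi_i$ and identify each $p_i$-occurrence of $\phi$ with the root of the copy of $\psi_i$ (keeping the label of that root). For $p$ not occurring in $\phi$: if the root $r$ of $\phi$ is on no cycle, $\langle\phi/p\rangle:=\phi$; otherwise $\langle\phi/p\rangle$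 adds a fresh vertex labelled $p$ with no successors and redirects every edge into $r$ to that new vertex (root still $r$); $\langle\phi/\psi\rangle:=\langle\phi/p\rangle[p:\psi]$. $\mathsf{CHL}$: the least set of cyclic formulas containing all substitution instances of propositional tautologies, all $\Box(\phi\to\psi)\to(\Box\phi\to\Box\psi)$, all $\phi\leftrightarrow\psi$ with $\phi\simeq\psi$, and closed under modus ponens, necessitation ($\vdash\phi\Rightarrow\vdash\Box\phi$) and Löb's rule ($\vdash\Box\phi\to\phi\Rightarrow\vdash\phi$). $\mathsf{GL}$ is the usual Löb logic (K plus Löb's rule plus $\Box\phi\to\Box\Box\phi$) on acyclic formulas. The map $\mathsf{js}$: for a formula $\phi$ and vertex $a$, define $\mathsf{js}^\star(\phi,a)$ (by course-of-values induction on the number of cycles of $\phi$ and, inside, recursion along $\hat S$ which is well-founded once the $\Box$-occurrences lying on cycles are treated as base cases): if $a$ is not a $\Box$-occurrence lying on a cycle and has label $\$$ of arity $n$, then $\mathsf{js}^\star(\phi,a):=\$(\mathsf{js}^\star(\phi,S_0a),\dots,\mathsf{js}^\star(\phi,S_{n-1}a))$ (a variable occurrence of $p$ gives $p$); if $a$ is a $\Box$-occurrence on a cycle, $\mathsf{js}^\star(\phi,a):=\mathsf{js}^\star(\langle\langle\phi\rangle_a/\top\rangle,a)$. Finally $\mathsf{js}(\phi):=\mathsf{js}^\star(\phi,r_\phi)$. *)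

(* Defs.v *)
From mathcomp Require Import all_boot.
From Stdlib Require Import FunctionalExtensionality.

Set Implicit Arguments.
Unset Strict Implicit.
Unset Printing Implicit Defensive.

Inductive label : Type :=
  | Lbot | Ltop | Lvar of nat | Lneg | Lbox | Land | Lor | Limp.

Definition arity (l : label) : nat :=
  match l with
  | Lbot | Ltop | Lvar _ => 0
  | Lneg | Lbox => 1
  | Land | Lor | Limp => 2
  end.

Definition is_box (l : label) : bool := if l is Lbox then true else false.

Definition is_var (p : nat) (l : label) : bool :=
  if l is Lvar q then q == p else false.

(* No reachability requirement here; it is imposed in [cform]. *)
Record pregraph : Type := PreGraph {
  vert : finType;
  root : vert;
  lab : vert -> label;
  succs : vert -> seq vert;
  size_succs : forall a, size (succs a) = arity (lab a)
}.

Arguments root : clear implicits.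
Arguments lab {p} a.
Arguments succs {p} a.

(* [nsucc a i] is S_i(a); meaningful for [i < arity (lab a)] only. *)
Definition nsucc (G : pregraph) (a : vert G) (i : nat) : vert G :=
  nth a (succs a) i.

Definition edge (G : pregraph) : rel (vert G) := fun a b => b \in succs a.
Arguments edge : clear implicits.

Definition is_cycle (G : pregraph) (c : seq (vert G)) : Prop :=
  c <> [::] /\ ucycle (edge G) c.

Definition on_cycle (G : pregraph) (a : vert G) : bool :=
  [exists b, edge G a b && connect (edge G) b a].

Definition acyclic (G : pregraph) : Prop :=
  forall c : seq (vert G), ~ is_cycle c.

Definition boxed (G : pregraph) : Prop :=
  forall c : seq (vert G), is_cycle c -> has (fun a => is_box (lab a)) c.

Record cform : Type := CForm {
  cgraph :> pregraph;
  cform_reach : forall a, connect (edge cgraph) (root cgraph) a;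
  cform_boxed : boxed cgraph
}.

Definition bisimulation (G H : pregraph) (R : vert G -> vert H -> Prop) : Prop :=
  forall a b, R a b ->
    lab a = lab b /\
    forall i, i < arity (lab a) -> R (nsucc a i) (nsucc b i).

Definition bisimilar (G H : pregraph) : Prop :=
  exists R : vert G -> vert H -> Prop,
    bisimulation R /\ R (root G) (root H).

Lemma edge_nsucc (G : pregraph) (a : vert G) (i : nat) :
  i < arity (lab a) -> edge G a (nsucc a i).
Proof. by move=> lt_i; rewrite /edge /nsucc mem_nth // size_succs. Qed.

Lemma cycle_on_cycle (G : pregraph) (c : seq (vert G)) :
  cycle (edge G) c -> {in c, forall a, on_cycle a}.
Proof.
move=> cyc_c a /rot_to [i s def_s].
have: cycle (edge G) (a :: s) by rewrite -def_s rot_cycle.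
case: s {def_s} => [|b s] /=.
  by rewrite andbT => e_aa; apply/existsP; exists a; rewrite e_aa connect0.
rewrite rcons_path => /and3P [e_ab path_s e_la].
apply/existsP; exists b; rewrite e_ab /=; apply/connectP.
by exists (rcons s a); rewrite ?rcons_path ?path_s ?last_rcons.
Qed.

Lemma on_cycleP (G : pregraph) (a : vert G) :
  reflect (exists2 c : seq (vert G), is_cycle c & a \in c) (on_cycle a).
Proof.
apply: (iffP idP) => [/existsP [b /andP [e_ab /connectP [p path_p def_a]]]|].
  case/shortenP: path_p def_a => p' path_p' uniq_p' _ def_a.
  exists (b :: p'); last by rewrite def_a mem_last.
  split=> //; rewrite /ucycle uniq_p' andbT /= rcons_path path_p' -def_a.
  exact: e_ab.
by case=> c [_ /andP [cyc_c _]]; apply: cycle_on_cycle.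
Qed.

Lemma on_cycle_walk (G : pregraph) (a : vert G) :
  on_cycle a -> exists2 c : seq (vert G), cycle (edge G) c & a \in c.
Proof. by case/on_cycleP=> c [_ /andP [cyc_c _]] c_a; exists c. Qed.

(* [rank stop a] decreases along every edge that leaves a non-[stop] vertex, as
   soon as every cycle meets [stop]. *)
Definition rank (G : pregraph) (stop : pred (vert G)) (a : vert G) : nat :=
  #|connect (fun x y => edge G x y && ~~ stop x) a|.

Lemma rank_lt (G : pregraph) (stop : pred (vert G)) (a b : vert G) :
    (forall c, is_cycle c -> has stop c) ->
  edge G a b -> ~~ stop a -> rank stop b < rank stop a.
Proof.
move=> stopG e_ab nstop_a; set e := fun x y => edge G x y && ~~ stop x.
apply: proper_card; apply/properP; split.
  apply/subsetP=> x bx; apply: (@connect_trans _ e b) => //.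
  by apply: connect1; rewrite /e e_ab.
exists a; first exact: (connect0 e).
apply/negP => /(connectP (e := e)) [p path_p def_a].
case/shortenP: path_p def_a => p' path_p' uniq_p' _ def_a.
have cyc: cycle e (b :: p') by rewrite /= rcons_path path_p' -def_a /e e_ab.
have: is_cycle (b :: p').
  split=> //; rewrite /ucycle uniq_p' andbT.
  by apply: sub_cycle cyc => x y /andP [].
move/stopG/hasP=> [x p'x stop_x].
have /allP /(_ _ p'x) : all (fun x => ~~ stop x) (b :: p').
  apply/allP=> y /rot_to [i s def_s].
  have: cycle e (y :: s) by rewrite -def_s rot_cycle.
  by case: s {def_s} => [|z s] /= /andP [/andP []].
by rewrite stop_x.
Qed.

Lemma rank_boxed (G : pregraph) (stop : pred (vert G)) (f : vert G -> nat) :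
    (forall a b, edge G a b -> ~~ stop a -> f b < f a) ->
  forall c, is_cycle c -> has stop c.
Proof.
move=> f_lt [|x p] [] // _ /andP [cyc_c _].
apply: contraT => /hasPn nstop.
have cyc': cycle (fun a b => f b < f a) (x :: p).
  rewrite -(@eq_in_cycle _ (mem (x :: p)) (fun a b => (f b < f a) || edge G a b)).
  - by apply: sub_cycle cyc_c => a b ->; rewrite orbT.
  - move=> a b pa _ /=; case e_ab: (edge G a b); last by rewrite orbF.
    by rewrite orbT f_lt // nstop.
  - by apply/allP.
have tr: transitive (fun a b => f b < f a).
  by move=> b a d lt1 lt2; apply: ltn_trans lt2 lt1.
have /allP /(_ x) := order_path_min tr cyc'.
by rewrite mem_rcons inE eqxx ltnn => /(_ isT).
Qed.

Lemma box_rank_boxed (G : pregraph) (f : vert G -> nat) :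
    (forall a b, edge G a b -> ~~ is_box (lab a) -> f b < f a) -> boxed G.
Proof. exact: rank_boxed. Qed.

Definition box_rank (G : pregraph) : vert G -> nat :=
  rank (fun a => is_box (lab a)).

Lemma box_rank_lt (phi : cform) (a b : vert phi) :
  edge phi a b -> ~~ is_box (lab a) -> box_rank b < box_rank a.
Proof. by apply: rank_lt; apply: cform_boxed. Qed.

Definition gen_vert (G : pregraph) (a : vert G) : finType :=
  {x : vert G | connect (edge G) a x}.

Definition gen_root (G : pregraph) (a : vert G) : gen_vert a :=
  exist _ a (connect0 _ a).

(* All successors of a reachable vertex are reachable, so the default value of
   [insubd] is never used. *)
Definition gen_succs (G : pregraph) (a : vert G) (x : gen_vert a) :
    seq (gen_vert a) :=
  [seq insubd x y | y <- succs (val x)].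

Lemma size_gen_succs (G : pregraph) (a : vert G) (x : gen_vert a) :
  size (gen_succs x) = arity (lab (val x)).
Proof. by rewrite size_map size_succs. Qed.

Definition gen_pre (G : pregraph) (a : vert G) : pregraph :=
  @PreGraph (gen_vert a) (gen_root a) (fun x => lab (val x)) (@gen_succs G a)
    (@size_gen_succs G a).

Lemma gen_edge (G : pregraph) (a : vert G) (x y : vert (gen_pre a)) :
  edge (gen_pre a) x y = edge G (val x) (val y).
Proof.
rewrite /edge /=; apply/mapP/idP => [[z z_x ->]|y_x].
  rewrite val_insubd ifT //; apply: connect_trans (valP x) _.
  exact: connect1.
by exists (val y); rewrite ?valKd.
Qed.

Lemma gen_reach (G : pregraph) (a : vert G) (x : vert (gen_pre a)) :
  connect (edge (gen_pre a)) (root (gen_pre a)) x.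
Proof.
suff gen_path p (y : gen_vert a) : path (edge G) (val y) p ->
    last (val y) p = val x -> connect (edge (gen_pre a)) y x.
  by case/connectP: (valP x) => p path_p def_x; apply: (gen_path p).
elim: p y => [|z p IHp] y /= => [_ /val_inj ->|/andP [e_yz path_p] last_p].
  exact: connect0.
have az: connect (edge G) a z.
  by apply: connect_trans (valP y) _; apply: connect1.
apply: connect_trans (IHp (exist _ z az) path_p last_p).
by apply: connect1; rewrite gen_edge.
Qed.

Lemma gen_boxed (G : pregraph) (a : vert G) : boxed G -> boxed (gen_pre a).
Proof.
move=> boxG.
apply: (box_rank_boxed (f := fun x : vert (gen_pre a) => box_rank (val x))) => x y.
by rewrite gen_edge => e_xy nbox; apply: (rank_lt (stop := fun b => is_box (lab b))).
Qed.

Definition gen_of (G : pregraph) (boxG : boxed G) (a : vert G) : cform :=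
  @CForm (gen_pre a) (@gen_reach G a) (gen_boxed boxG).

Definition gen (phi : cform) (a : vert phi) : cform :=
  gen_of (@cform_boxed phi) a.

Definition op_vert (n : nat) (args : 'I_n -> cform) : finType :=
  option {i : 'I_n & vert (args i)}.

Definition op_in (n : nat) (args : 'I_n -> cform) (i : 'I_n)
    (x : vert (args i)) : op_vert args :=
  Some (Tagged (fun i => vert (args i)) x).

Definition op_lab (l : label) (args : 'I_(arity l) -> cform)
    (u : op_vert args) : label :=
  if u is Some (existT _ x) then lab x else l.

Definition op_succs (l : label) (args : 'I_(arity l) -> cform)
    (u : op_vert args) : seq (op_vert args) :=
  match u with
  | Some (existT i x) => [seq op_in y | y <- succs x]
  | None => [seq op_in (root (args i)) | i <- enum 'I_(arity l)]
  end.

Lemma size_op_succs (l : label) (args : 'I_(arity l) -> cform)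
  (u : op_vert args) : size (op_succs u) = arity (op_lab u).
Proof. by case: u => [[i x]|] /=; rewrite size_map ?size_succs ?size_enum_ord. Qed.

Definition op_pre (l : label) (args : 'I_(arity l) -> cform) : pregraph :=
  @PreGraph (op_vert args) None (@op_lab l args) (@op_succs l args)
    (@size_op_succs l args).

Lemma op_reach (l : label) (args : 'I_(arity l) -> cform) (u : op_vert args) :
  connect (edge (op_pre args)) (root (op_pre args)) u.
Proof.
case: u => [[i x]|]; last exact: connect0.
apply: (@connect_trans _ _ (op_in (root (args i)))).
  by apply: connect1; apply/mapP; exists i; rewrite ?mem_enum.
case/connectP: (cform_reach x) => p path_p ->.
elim: p (root _) path_p => [|y p IHp] z /=; first by rewrite connect0.
case/andP=> e_zy /IHp; apply: connect_trans.
by apply: connect1; apply/mapP; exists y.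
Qed.

Lemma op_boxed (l : label) (args : 'I_(arity l) -> cform) : boxed (op_pre args).
Proof.
pose f (u : vert (op_pre args)) := if u is Some (existT i x) then box_rank x
  else (\max_(i < arity l) box_rank (root (args i))).+1.
apply: (box_rank_boxed (f := f)) => -[[i x]|] v /mapP [y e_xy ->] /=.
  exact: box_rank_lt.
by rewrite ltnS (@leq_bigmax 'I_(arity l) (fun i => box_rank (root (args i)))).
Qed.

Definition cop (l : label) (args : 'I_(arity l) -> cform) : cform :=
  @CForm (op_pre args) (@op_reach l args) (@op_boxed l args).

Definition no_arg (i : 'I_0) : cform := False_rect _ (notF (ltn_ord i)).
Definition pair_arg (phi psi : cform) (i : 'I_2) : cform :=
  if i == 0 :> nat then phi else psi.

Definition cbot : cform := @cop Lbot no_arg.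
Definition ctop : cform := @cop Ltop no_arg.
Definition cvar (p : nat) : cform := @cop (Lvar p) no_arg.
Definition cneg (phi : cform) : cform := @cop Lneg (fun=> phi).
Definition cbox (phi : cform) : cform := @cop Lbox (fun=> phi).
Definition cand (phi psi : cform) : cform := @cop Land (pair_arg phi psi).
Definition cor (phi psi : cform) : cform := @cop Lor (pair_arg phi psi).
Definition cimp (phi psi : cform) : cform := @cop Limp (pair_arg phi psi).
Definition ciff (phi psi : cform) : cform := cand (cimp phi psi) (cimp psi phi).

(* The substitution [q_0 : chi_0, ..., q_(k-1) : chi_(k-1)] is given by the
   families [q] and [chi]; [q] is meant to be injective.  Identifying the
   q_i-occurrences of [phi] with the root of [chi i] amounts to redirecting to
   that root all edges into them (and the root of the graph, if it is one of
   them); the old occurrences and the copies of the [chi i] such that [q i]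
   does not occur in [phi] become unreachable and are dropped. *)
Definition sub_vert (phi : cform) (k : nat) (chi : 'I_k -> cform) : finType :=
  (vert phi + {i : 'I_k & vert (chi i)})%type.

Definition sub_in (phi : cform) (k : nat) (chi : 'I_k -> cform) (i : 'I_k)
    (x : vert (chi i)) : sub_vert phi chi :=
  inr (Tagged (fun i => vert (chi i)) x).
Arguments sub_in phi {k chi i} x.

Definition sub_dir (phi : cform) (k : nat) (q : 'I_k -> nat)
    (chi : 'I_k -> cform) (a : vert phi) : sub_vert phi chi :=
  if [pick i | is_var (q i) (lab a)] is Some i
  then sub_in phi (root (chi i)) else inl a.

Definition sub_lab (phi : cform) (k : nat) (chi : 'I_k -> cform)
    (u : sub_vert phi chi) : label :=
  match u with inl a => lab a | inr (existT _ x) => lab x end.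

Definition sub_succs (phi : cform) (k : nat) (q : 'I_k -> nat)
    (chi : 'I_k -> cform) (u : sub_vert phi chi) : seq (sub_vert phi chi) :=
  match u with
  | inl a => [seq sub_dir q chi b | b <- succs a]
  | inr (existT _ x) => [seq sub_in phi y | y <- succs x]
  end.

Lemma size_sub_succs (phi : cform) (k : nat) (q : 'I_k -> nat)
    (chi : 'I_k -> cform) (u : sub_vert phi chi) :
  size (sub_succs q u) = arity (sub_lab u).
Proof. by case: u => [a|[i x]] /=; rewrite size_map size_succs. Qed.

Definition sub_pre (phi : cform) (k : nat) (q : 'I_k -> nat)
    (chi : 'I_k -> cform) : pregraph :=
  @PreGraph (sub_vert phi chi) (sub_dir q chi (root phi))
    (@sub_lab phi k chi) (@sub_succs phi k q chi) (@size_sub_succs phi k q chi).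

Lemma sub_boxed (phi : cform) (k : nat) (q : 'I_k -> nat)
    (chi : 'I_k -> cform) : boxed (sub_pre phi q chi).
Proof.
pose M := \max_(i < k) box_rank (root (chi i)).
pose f (u : vert (sub_pre phi q chi)) := match u with
  inl a => box_rank a + M | inr (existT _ x) => box_rank x end.
apply: (box_rank_boxed (f := f)) => -[a|[i x]] v /mapP [y e_xy ->] /= nbox.
  have lt_ya: box_rank y < box_rank a by apply: box_rank_lt.
  rewrite /sub_dir; case: pickP => [i _|_] /=; last by rewrite ltn_add2r.
  rewrite -add1n leq_add //; first by apply: leq_trans lt_ya.
  exact: (@leq_bigmax 'I_k (fun i => box_rank (root (chi i)))).
exact: box_rank_lt.
Qed.

Definition csubst (phi : cform) (k : nat) (q : 'I_k -> nat)
    (chi : 'I_k -> cform) : cform :=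
  gen_of (@sub_boxed phi k q chi) (root (sub_pre phi q chi)).

Definition csubst1 (phi : cform) (p : nat) (psi : cform) : cform :=
  @csubst phi 1 (fun=> p) (fun=> psi).

Definition cut_dir (phi : cform) (a : vert phi) : option (vert phi) :=
  if a == root phi then None else Some a.

Definition cut_lab (phi : cform) (p : nat) (u : option (vert phi)) : label :=
  if u is Some a then lab a else Lvar p.

Definition cut_succs (phi : cform) (u : option (vert phi)) :
    seq (option (vert phi)) :=
  if u is Some a then [seq cut_dir b | b <- succs a] else [::].

Lemma size_cut_succs (phi : cform) (p : nat) (u : option (vert phi)) :
  size (cut_succs u) = arity (cut_lab p u).
Proof. by case: u => [a|] //=; rewrite size_map size_succs. Qed.

Definition cut_pre (phi : cform) (p : nat) : pregraph :=
  @PreGraph (option (vert phi)) (Some (root phi)) (@cut_lab phi p)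
    (@cut_succs phi) (@size_cut_succs phi p).

Lemma cut_reach (phi : cform) (p : nat) :
  on_cycle (root phi) ->
  forall u, connect (edge (cut_pre phi p)) (root (cut_pre phi p)) u.
Proof.
move=> cyc_r.
have reachS (a : vert phi) :
    connect (edge (cut_pre phi p)) (root (cut_pre phi p)) (Some a).
  case/connectP: (cform_reach a) => s path_s def_a.
  case/shortenP: path_s def_a => s' path_s' /= /andP [r_s' _] _ -> {s a}.
  suff walk s x : path (edge phi) x s -> root phi \notin s ->
      connect (edge (cut_pre phi p)) (Some x) (Some (last x s)).
    exact: walk.
  elim: s x => [|b s IHs] x /=; first by rewrite connect0.
  move=> /andP [e_xb path_s]; rewrite inE negb_or => /andP [ne_rb r_s].
  apply: connect_trans (IHs _ path_s r_s); apply: connect1.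
  by apply/mapP; exists b; rewrite // /cut_dir eq_sym (negbTE ne_rb).
case=> [a|]; first exact: reachS.
case/on_cycleP: cyc_r => c [_ /andP [cyc_c uniq_c]] c_r.
have e_r := prev_cycle cyc_c c_r.
apply: connect_trans (reachS (prev c (root phi))) _; apply: connect1.
by apply/mapP; exists (root phi); rewrite // /cut_dir eqxx.
Qed.

Lemma cut_boxed (phi : cform) (p : nat) : boxed (cut_pre phi p).
Proof.
pose f (u : vert (cut_pre phi p)) := if u is Some a then (box_rank a).+1 else 0.
apply: (box_rank_boxed (f := f)) => -[a|] // v /mapP [b e_ab ->] /= nbox.
rewrite /cut_dir; case: eqP => //= _; rewrite ltnS.
exact: box_rank_lt.
Qed.

(* The formula <phi/p>, for [p] not occurring in [phi]: the edges into a root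
   lying on a cycle are redirected to a new vertex labelled [p], here [None]. *)
Definition cut (phi : cform) (p : nat) : cform :=
  match Sumbool.sumbool_of_bool (on_cycle (root phi)) with
  | left cyc_r =>
      @CForm (cut_pre phi p) (@cut_reach phi p cyc_r) (@cut_boxed phi p)
  | right _ => phi
  end.

Definition occurs (p : nat) (phi : cform) : bool :=
  [exists a : vert phi, is_var p (lab a)].

Definition fresh (phi : cform) : nat :=
  (\max_(a : vert phi) (if lab a is Lvar p then p else 0)).+1.

Lemma freshP (phi : cform) : ~~ occurs (fresh phi) phi.
Proof.
apply/existsP => -[a]; rewrite /is_var.
case lab_a: (lab a) => [||p|||||] //= /eqP def_p.
suff: p < fresh phi by rewrite def_p ltnn.
pose F (b : vert phi) := if lab b is Lvar p then p else 0.
rewrite /fresh ltnS -[p]/(if Lvar p is Lvar p then p else 0) -lab_a.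
exact: (@leq_bigmax (vert phi) F a).
Qed.

(* The formula <phi/psi>; up to isomorphism the choice of the fresh variable is
   immaterial. *)
Definition cut_subst (phi psi : cform) : cform :=
  csubst1 (cut phi (fresh phi)) (fresh phi) psi.

Definition cyc_box (phi : cform) (a : vert phi) : bool :=
  is_box (lab a) && on_cycle a.

Definition point : Type := {phi : cform & vert phi}.
Definition at_ (phi : cform) (a : vert phi) : point := existT _ phi a.

Inductive js_call : point -> point -> Prop :=
  | js_call_succ (phi : cform) (a : vert phi) (i : nat) :
      ~~ cyc_box a -> i < arity (lab a) ->
      js_call (at_ (nsucc a i)) (at_ a)
  | js_call_cut (phi : cform) (a : vert phi) :
      cyc_box a ->
      js_call (at_ (root (cut_subst (gen a) ctop))) (at_ a).

(* Termination measure: the number of vertices lying on a cycle.  Any measure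
   would do, since [js_star] is determined by its recursion equation
   [js_starE]. *)
Definition ncyc (G : pregraph) : nat := #|[pred a : vert G | on_cycle a]|.

Lemma on_cycle_edge (G : pregraph) (a : vert G) :
  on_cycle a -> exists2 b, on_cycle b & edge G b a.
Proof.
case/on_cycle_walk=> c cyc_c c_a; exists (prev c a).
  by apply: (cycle_on_cycle cyc_c); rewrite mem_prev.
exact: prev_cycle.
Qed.

Lemma on_cycle_succ (G : pregraph) (a : vert G) :
  on_cycle a -> exists b, edge G a b.
Proof. by case/existsP=> b /andP [e_ab _]; exists b. Qed.

Lemma on_cycle_map (G H : pregraph) (h : vert G -> vert H) (a : vert G) :
    (forall x y, on_cycle x -> on_cycle y -> edge G x y -> edge H (h x) (h y)) ->
  on_cycle a -> on_cycle (h a).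
Proof.
move=> h_edge /on_cycle_walk [c cyc_c c_a].
apply: (@cycle_on_cycle H (map h c)); last exact: map_f.
rewrite cycle_map; apply: sub_in_cycle (cyc_c); last by apply/allP => x; exact: id.
move=> x y c_x c_y /=; apply: h_edge; exact: (cycle_on_cycle cyc_c).
Qed.

Lemma ncyc_map (G H : pregraph) (h : vert G -> vert H) (P : pred (vert H)) :
    (forall x y, on_cycle x -> on_cycle y -> edge G x y -> edge H (h x) (h y)) ->
    (forall x y, on_cycle x -> on_cycle y -> h x = h y -> x = y) ->
    (forall x, on_cycle x -> P (h x)) ->
  ncyc G <= #|[pred a | on_cycle a && P a]|.
Proof.
move=> h_edge h_inj hP; rewrite /ncyc -(card_in_imset (f := h)); last first.
  by move=> x y; rewrite !inE; apply: h_inj.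
apply/subset_leq_card/subsetP=> _ /imsetP [x cyc_x ->].
by rewrite inE hP // (on_cycle_map h_edge).
Qed.

Lemma ncyc_mapT (G H : pregraph) (h : vert G -> vert H) :
    (forall x y, on_cycle x -> on_cycle y -> edge G x y -> edge H (h x) (h y)) ->
    (forall x y, on_cycle x -> on_cycle y -> h x = h y -> x = y) ->
  ncyc G <= ncyc H.
Proof.
move=> h_edge h_inj; apply: leq_trans (ncyc_map (P := predT) h_edge h_inj _) _ => //.
by rewrite /ncyc; apply/eq_leq/eq_card => x; rewrite !inE andbT.
Qed.

Lemma ncyc_gen (G : pregraph) (a : vert G) : ncyc (gen_pre a) <= ncyc G.
Proof.
apply: (@ncyc_mapT (gen_pre a) G val) => x y _ _; first by rewrite gen_edge.
exact: val_inj.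
Qed.

Lemma ncyc_cut (phi : cform) (p : nat) :
  on_cycle (root phi) -> ncyc (cut phi p) < ncyc phi.
Proof.
move=> cyc_r; rewrite /cut.
case: Sumbool.sumbool_of_bool => [_ /=|]; last by rewrite cyc_r.
pose h (u : vert (cut_pre phi p)) := odflt (root phi) u.
have cycS (u : vert (cut_pre phi p)) : on_cycle u ->
    exists2 a, u = Some a & a != root phi.
  move=> cyc_u; case/on_cycle_succ: (cyc_u) => v; case: u cyc_u => // a.
  case/on_cycle_edge=> -[b|] _ // /mapP [c _].
  by rewrite /cut_dir; case: eqP => // /eqP ne_c [->] _; exists c.
have lt_card: #|[pred a : vert phi | on_cycle a && (a != root phi)]| < ncyc phi.
  rewrite /ncyc [X in _ < X](cardD1 (root phi)) inE cyc_r add1n ltnS.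
  by apply/eq_leq/eq_card => a; rewrite !inE andbC.
apply: leq_ltn_trans lt_card.
apply: (@ncyc_map (cut_pre phi p) phi h (fun a => a != root phi)).
- move=> x y /cycS [a -> _] /cycS [b -> _] /mapP [c c_a].
  by rewrite /cut_dir; case: eqP => // _ [->].
- by move=> x y /cycS [a -> _] /cycS [b -> _] /= ->.
- by move=> x /cycS [a -> ne_a].
Qed.

Lemma ncyc_subst1 (phi : cform) (p : nat) :
  ncyc (csubst1 phi p ctop) <= ncyc phi.
Proof.
apply: leq_trans (ncyc_gen _) _.
set G := sub_pre _ _ _.
pose h (u : vert G) : vert phi := if u is inl a then a else root phi.
have cycL (u : vert G) : on_cycle u -> exists a, u = inl a.
  case/on_cycle_succ=> v; case: u => [a|[i [[[]]|]]] //; first by exists a.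
  by case/mapP=> y /mapP [[]].
apply: (@ncyc_mapT G phi h).
- move=> x y /cycL [a ->] /cycL [b ->] /mapP [c c_a].
  by rewrite /sub_dir; case: pickP => // _ [->].
- by move=> x y /cycL [a ->] /cycL [b ->] /= ->.
Qed.

Lemma on_cycle_gen (G : pregraph) (a : vert G) :
  on_cycle a -> on_cycle (root (gen_pre a)).
Proof.
case/existsP=> b /andP [e_ab /connectP [p path_p def_a]].
have ab: connect (edge G) a b by apply: connect1.
apply/existsP; exists (exist _ b ab); rewrite gen_edge e_ab /=.
suff gen_path (x y : gen_vert a) s : path (edge G) (val x) s ->
    last (val x) s = val y -> connect (edge (gen_pre a)) x y.
  exact: (gen_path _ _ p).
elim: s x => [|z s IHs] x /= => [_ /val_inj ->|/andP [e_xz path_s] last_s].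
  exact: connect0.
have az: connect (edge G) a z.
  by apply: connect_trans (valP x) _; apply: connect1.
apply: connect_trans (IHs (exist _ z az) path_s last_s).
by apply: connect1; rewrite gen_edge.
Qed.

Lemma ncyc_call (phi : cform) (a : vert phi) :
  on_cycle a -> ncyc (cut_subst (gen a) ctop) < ncyc phi.
Proof.
move=> cyc_a; apply: leq_ltn_trans (ncyc_subst1 _ _) _.
apply: (@leq_trans (ncyc (gen a))); last exact: ncyc_gen.
by apply: ncyc_cut; apply: on_cycle_gen.
Qed.

Lemma cycle_cyc_box (phi : cform) (c : seq (vert phi)) :
  is_cycle c -> has (@cyc_box phi) c.
Proof.
move=> cyc_c; have /hasP [a c_a box_a] := cform_boxed cyc_c.
apply/hasP; exists a; rewrite // /cyc_box box_a /=.
by apply/on_cycleP; exists c.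
Qed.

Lemma js_call_inv (y x : point) :
  js_call y x ->
  (exists2 i, ~~ cyc_box (projT2 x) /\ i < arity (lab (projT2 x)) &
     y = at_ (nsucc (projT2 x) i)) \/
  (cyc_box (projT2 x) /\ y = at_ (root (cut_subst (gen (projT2 x)) ctop))).
Proof. by case=> phi a => [i ncyc_a lt_i|cyc_a]; [left; exists i|right]. Qed.

Lemma js_call_wf : well_founded js_call.
Proof.
suff acc n (phi : cform) : ncyc phi < n -> forall a : vert phi, Acc js_call (at_ a).
  by case=> phi a; apply: (acc (ncyc phi).+1).
elim: n phi => [|n IHn] phi; first by rewrite ltn0.
rewrite ltnS => le_n.
suff acc m (a : vert phi) : rank (@cyc_box phi) a < m -> Acc js_call (at_ a).
  by move=> a; apply: (acc (rank (@cyc_box phi) a).+1).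
elim: m a => [|m IHm] a; first by rewrite ltn0.
rewrite ltnS => le_m; constructor => y call_y.
move/js_call_inv: call_y => /=.
case=> [[i [ncyc_a lt_i] ->]|[/andP [_ cyc_a] ->]].
  apply: IHm; apply: leq_trans le_m; apply: rank_lt ncyc_a.
    exact: cycle_cyc_box.
  exact: edge_nsucc.
by apply: IHn; apply: leq_trans le_n; apply: ncyc_call.
Qed.

Definition js_step (x : point) : (forall y, js_call y x -> cform) -> cform :=
  match x with
  | existT phi a => fun js_rec =>
      match Sumbool.sumbool_of_bool (cyc_box a) with
      | left cyc_a => js_rec _ (js_call_cut cyc_a)
      | right ncyc_a =>
          @cop (lab a) (fun i =>
            js_rec _ (js_call_succ (negbT ncyc_a) (ltn_ord i)))
      end
  end.

Definition js_star (phi : cform) (a : vert phi) : cform :=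
  Fix js_call_wf (fun=> cform) js_step (at_ a).

Definition js (phi : cform) : cform := js_star (root phi).

Lemma js_starE (phi : cform) (a : vert phi) :
  js_star a =
    if is_box (lab a) && on_cycle a
    then js_star (root (cut_subst (gen a) ctop))
    else @cop (lab a) (fun i => js_star (nsucc a i)).
Proof.
rewrite {1}/js_star Fix_eq => [|[psi b] f g eq_fg] /=.
  by rewrite -/(cyc_box a); case: Sumbool.sumbool_of_bool => ->.
case: Sumbool.sumbool_of_bool => [cyc_b|ncyc_b]; first exact: eq_fg.
by congr cop; apply: functional_extensionality => i; apply: eq_fg.
Qed.

Inductive form : Type :=
  | Bot | Top
  | Var of nat
  | Neg of form
  | Box of form
  | And of form & form
  | Or of form & form
  | Imp of form & form.

Fixpoint embed (f : form) : cform :=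
  match f with
  | Bot => cbot
  | Top => ctop
  | Var p => cvar p
  | Neg f => cneg (embed f)
  | Box f => cbox (embed f)
  | And f g => cand (embed f) (embed g)
  | Or f g => cor (embed f) (embed g)
  | Imp f g => cimp (embed f) (embed g)
  end.

Fixpoint fsubst (s : nat -> form) (f : form) : form :=
  match f with
  | Bot => Bot
  | Top => Top
  | Var p => s p
  | Neg f => Neg (fsubst s f)
  | Box f => Box (fsubst s f)
  | And f g => And (fsubst s f) (fsubst s g)
  | Or f g => Or (fsubst s f) (fsubst s g)
  | Imp f g => Imp (fsubst s f) (fsubst s g)
  end.

Fixpoint propositional (f : form) : bool :=
  match f with
  | Bot | Top | Var _ => true
  | Neg f => propositional f
  | Box _ => false
  | And f g | Or f g | Imp f g => propositional f && propositional g
  end.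

(* The value on boxed formulas is irrelevant: see [tautology]. *)
Fixpoint truth (v : nat -> bool) (f : form) : bool :=
  match f with
  | Bot => false
  | Top => true
  | Var p => v p
  | Neg f => ~~ truth v f
  | Box _ => false
  | And f g => truth v f && truth v g
  | Or f g => truth v f || truth v g
  | Imp f g => truth v f ==> truth v g
  end.

Definition tautology (t : form) : Prop :=
  propositional t /\ forall v : nat -> bool, truth v t.

Inductive GL_form : form -> Prop :=
  | GL_taut (t : form) (s : nat -> form) :
      tautology t -> GL_form (fsubst s t)
  | GL_K (f g : form) :
      GL_form (Imp (Box (Imp f g)) (Imp (Box f) (Box g)))
  | GL_4 (f : form) : GL_form (Imp (Box f) (Box (Box f)))
  | GL_mp (f g : form) : GL_form (Imp f g) -> GL_form f -> GL_form g
  | GL_nec (f : form) : GL_form f -> GL_form (Box f)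
  | GL_loeb (f : form) : GL_form (Imp (Box f) f) -> GL_form f.

(* An acyclic formula is identified with the ordinary modal formula, unique if
   it exists, to whose syntax tree it is bisimilar. *)
Definition GL (phi : cform) : Prop :=
  exists2 f : form, GL_form f & bisimilar (embed f) phi.

(* In [CHL_taut], [csubst] lets all occurrences of a variable of [t] share one
   copy of the formula substituted for it, whereas the connectives take disjoint
   copies of their arguments.  Without the closure under bisimilarity, instances
   such as those of (phi <-> psi) -> (phi -> psi) would not have the form
   [cimp _ _] required by modus ponens. *)
Inductive CHL_plus (Ax : cform -> Prop) : cform -> Prop :=
  | CHL_ax (phi : cform) : Ax phi -> CHL_plus Ax phi
  | CHL_taut (t : form) (k : nat) (q : 'I_k -> nat) (chi : 'I_k -> cform)
      (phi : cform) :
      tautology t -> injective q -> bisimilar (csubst (embed t) q chi) phi ->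
      CHL_plus Ax phi
  | CHL_K (phi psi : cform) :
      CHL_plus Ax (cimp (cbox (cimp phi psi)) (cimp (cbox phi) (cbox psi)))
  | CHL_bisim (phi psi : cform) :
      bisimilar phi psi -> CHL_plus Ax (ciff phi psi)
  | CHL_mp (phi psi : cform) :
      CHL_plus Ax (cimp phi psi) -> CHL_plus Ax phi -> CHL_plus Ax psi
  | CHL_nec (phi : cform) : CHL_plus Ax phi -> CHL_plus Ax (cbox phi)
  | CHL_loeb (phi : cform) :
      CHL_plus Ax (cimp (cbox phi) phi) -> CHL_plus Ax phi.

Definition CHL : cform -> Prop := CHL_plus (fun=> False).

Definition axiom4 (chi : cform) : Prop :=
  exists phi : cform, chi = cimp (cbox phi) (cbox (cbox phi)).

Definition GLo : cform -> Prop := CHL_plus axiom4.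

(* Main.v *)
(* A solution of a cyclic formula assigns to every vertex a modal formula so that
   the formula at a vertex is GL-equivalent to the label of the vertex applied
   to the formulas at its successors.  Loeb's rule makes solutions unique up to
   GL-equivalence, even across bisimulations, and the fixed point theorem of
   de Jongh and Sambin makes them exist.  In the recursion for js, cutting a
   boxed vertex on a cycle and putting Top in its place is exactly the de
   Jongh-Sambin fixed point, so js computes the value of the solution at the
   root.  This value commutes with connectives and substitutions and turns the
   axioms and rules of GLo into theorems and rules of GL. *)

From HB Require Import structures.
From mathcomp Require Import all_boot.
From Stdlib Require Import Classical FunctionalExtensionality.
Require Import Defs.

Set Implicit Arguments.
Unset Strict Implicit.
Unset Printing Implicit Defensive.

(** * Propositional and modal reasoning in GL *)

Lemma form_eq_dec : comparable form.
Proof. by move=> f g; rewrite /decidable; do 2 decide equality. Qed.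

HB.instance Definition _ := hasDecEq.Build form (compareP form_eq_dec).

Notation Iff f g := (And (Imp f g) (Imp g f)).

(* Boxed formulas are treated as further atoms. *)
Fixpoint bool_val (w : form -> bool) (f : form) : bool :=
  match f with
  | Bot => false
  | Top => true
  | Var _ | Box _ => w f
  | Neg f => ~~ bool_val w f
  | And f g => bool_val w f && bool_val w g
  | Or f g => bool_val w f || bool_val w g
  | Imp f g => bool_val w f ==> bool_val w g
  end.

Fixpoint atoms (f : form) : seq form :=
  match f with
  | Bot | Top => [::]
  | Var _ | Box _ => [:: f]
  | Neg f => atoms f
  | And f g | Or f g | Imp f g => atoms f ++ atoms g
  end.

(** Variables and boxed subformulas become variables numbered by their position in [r]; substituting
    [nth Bot r] undoes this when [r] lists all the atoms. *)
Fixpoint skeleton (r : seq form) (f : form) : form :=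
  match f with
  | Bot | Top => f
  | Var _ | Box _ => Var (index f r)
  | Neg f => Neg (skeleton r f)
  | And f g => And (skeleton r f) (skeleton r g)
  | Or f g => Or (skeleton r f) (skeleton r g)
  | Imp f g => Imp (skeleton r f) (skeleton r g)
  end.

Lemma propositional_skeleton r f : propositional (skeleton r f).
Proof. by elim: f => //= f -> g ->. Qed.

Lemma truth_skeleton r v f :
  truth v (skeleton r f) = bool_val (fun g => v (index g r)) f.
Proof. by elim: f => //= [f ->|f -> g ->|f -> g ->|f -> g ->]. Qed.

Lemma fsubst_skeleton r f :
  {subset atoms f <= r} -> fsubst (nth Bot r) (skeleton r f) = f.
Proof.
elim: f => //= [p|f IHf|f _|f IHf g IHg|f IHf g IHg|f IHf g IHg] sub_r.
- by rewrite nth_index // sub_r // mem_head.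
- by rewrite IHf.
- by rewrite nth_index // sub_r // mem_head.
- by rewrite IHf ?IHg // => x x_in; apply: sub_r; rewrite mem_cat x_in ?orbT.
- by rewrite IHf ?IHg // => x x_in; apply: sub_r; rewrite mem_cat x_in ?orbT.
- by rewrite IHf ?IHg // => x x_in; apply: sub_r; rewrite mem_cat x_in ?orbT.
Qed.

Lemma GL_prop f : (forall w, bool_val w f) -> GL_form f.
Proof.
move=> val_f; rewrite -(@fsubst_skeleton (atoms f) f) //; apply: GL_taut.
by split=> [|v]; rewrite ?propositional_skeleton ?truth_skeleton.
Qed.

Lemma GL_prop1 f g :
  GL_form f -> (forall w, bool_val w (Imp f g)) -> GL_form g.
Proof. by move=> GLf /GL_prop GLfg; apply: GL_mp GLf. Qed.

Lemma GL_prop2 f g h :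
    GL_form f -> GL_form g -> (forall w, bool_val w (Imp f (Imp g h))) ->
  GL_form h.
Proof. by move=> GLf GLg val; apply: GL_mp GLg; apply: GL_prop1 GLf val. Qed.

Lemma GL_prop3 e f g h :
    GL_form e -> GL_form f -> GL_form g ->
    (forall w, bool_val w (Imp e (Imp f (Imp g h)))) ->
  GL_form h.
Proof. by move=> GLe GLf GLg val; apply: GL_mp GLg; apply: GL_prop2 GLe GLf val. Qed.

Ltac truth_table :=
  let w := fresh "w" in move=> w /=;
  repeat match goal with
  | |- context [bool_val w ?f] => case: (bool_val w f)
  | |- context [w ?f] => case: (w f)
  end; by [].

Lemma GL_box f g : GL_form (Imp f g) -> GL_form (Imp (Box f) (Box g)).
Proof. by move=> GLfg; apply: GL_mp (GL_K f g) (GL_nec GLfg). Qed.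

Lemma GL_box2 f g h :
  GL_form (Imp f (Imp g h)) -> GL_form (Imp (Box f) (Imp (Box g) (Box h))).
Proof. by move/GL_box=> GLfg; apply: GL_prop2 GLfg (GL_K g h) _; truth_table. Qed.

Lemma GL_box_iff h f g :
    GL_form (Imp h (Box (Iff f g))) -> GL_form (Imp h (Iff (Box f) (Box g))).
Proof.
move=> GLh.
have fg: GL_form (Imp (Iff f g) (Imp f g)) by apply: GL_prop; truth_table.
have gf: GL_form (Imp (Iff f g) (Imp g f)) by apply: GL_prop; truth_table.
by apply: GL_prop3 GLh (GL_box2 fg) (GL_box2 gf) _; truth_table.
Qed.

Definition equiv f g := GL_form (Iff f g).

Lemma equiv_refl f : equiv f f.
Proof. by apply: GL_prop; truth_table. Qed.

Lemma equiv_sym f g : equiv f g -> equiv g f.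
Proof. by move=> fg; apply: GL_prop1 fg _; truth_table. Qed.

Lemma equiv_trans f g h : equiv f g -> equiv g h -> equiv f h.
Proof. by move=> fg gh; apply: GL_prop2 fg gh _; truth_table. Qed.

Lemma equiv_GL f g : equiv f g -> GL_form f -> GL_form g.
Proof. by move=> fg GLf; apply: GL_prop2 fg GLf _; truth_table. Qed.

Lemma fsubst_comp s s' f :
  fsubst s' (fsubst s f) = fsubst (fun p => fsubst s' (s p)) f.
Proof. by elim: f => //= [f ->|f ->|f -> g ->|f -> g ->|f -> g ->]. Qed.

Lemma GL_subst s f : GL_form f -> GL_form (fsubst s f).
Proof.
elim=> {f} [t s' taut_t|f g|f|f g _ IHfg _|f _|f _] /=.
- by rewrite fsubst_comp; apply: GL_taut.
- exact: GL_K.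
- exact: GL_4.
- exact: GL_mp IHfg.
- exact: GL_nec.
- exact: GL_loeb.
Qed.

Lemma equiv_subst s f g : equiv f g -> equiv (fsubst s f) (fsubst s g).
Proof. exact: (@GL_subst s). Qed.

(** The children form a function on all of [nat], of which only the values below the arity count;
    this avoids families indexed by ['I_(arity l)]. *)
Definition node (l : label) (c : nat -> form) : form :=
  match l with
  | Lbot => Bot
  | Ltop => Top
  | Lvar p => Var p
  | Lneg => Neg (c 0)
  | Lbox => Box (c 0)
  | Land => And (c 0) (c 1)
  | Lor => Or (c 0) (c 1)
  | Limp => Imp (c 0) (c 1)
  end.

(** Since [h] need not pass under a box, a box requires the boxed equivalence of its arguments; the
    other connectives require only the equivalence itself. *)
Lemma GL_node h l c d :
    (is_box l -> GL_form (Imp h (Box (Iff (c 0) (d 0))))) ->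
    (~~ is_box l -> forall i, i < arity l -> GL_form (Imp h (Iff (c i) (d i)))) ->
  GL_form (Imp h (Iff (node l c) (node l d))).
Proof.
case: l => [||p|||||] /= box_cd cd; try by apply: GL_prop; truth_table.
- by apply: GL_prop1 (cd isT 0 isT) _; truth_table.
- exact: GL_box_iff (box_cd isT).
- by apply: GL_prop2 (cd isT 0 isT) (cd isT 1 isT) _; truth_table.
- by apply: GL_prop2 (cd isT 0 isT) (cd isT 1 isT) _; truth_table.
- by apply: GL_prop2 (cd isT 0 isT) (cd isT 1 isT) _; truth_table.
Qed.

Lemma equiv_node l c d :
  (forall i, i < arity l -> equiv (c i) (d i)) -> equiv (node l c) (node l d).
Proof.
move=> cd; suff: GL_form (Imp Top (Iff (node l c) (node l d))).
  by move=> GLcd; apply: GL_prop1 GLcd _; truth_table.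
apply: GL_node => [|_ i lt_i]; last by apply: GL_prop1 (cd i lt_i) _; truth_table.
case: l cd => // cd _.
by apply: GL_prop1 (GL_nec (cd 0 isT)) _; truth_table.
Qed.

Lemma eq_node l c d :
  (forall i, i < arity l -> c i = d i) -> node l c = node l d.
Proof. by case: l => //= cd; rewrite !cd. Qed.

(** Treats all connectives uniformly through [node]; variables stay apart because substitution acts
    on them. *)
Lemma node_ind (P : form -> Prop) :
    (forall p, P (Var p)) ->
    (forall l c, (forall p, l <> Lvar p) ->
       (forall i, i < arity l -> P (c i)) -> P (node l c)) ->
  forall f, P f.
Proof.
move=> Pvar Pnode; elim=> [||//|f Pf|f Pf|f Pf g Pg|f Pf g Pg|f Pf g Pg].
- exact: (Pnode Lbot (fun=> Bot)).
- exact: (Pnode Ltop (fun=> Bot)).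
- exact: (Pnode Lneg (fun=> f)).
- exact: (Pnode Lbox (fun=> f)).
- by apply: (Pnode Land (nth Bot [:: f; g])) => // -[|[]].
- by apply: (Pnode Lor (nth Bot [:: f; g])) => // -[|[]].
- by apply: (Pnode Limp (nth Bot [:: f; g])) => // -[|[]].
Qed.

Lemma fsubst_node s l c : (forall p, l <> Lvar p) ->
  fsubst s (node l c) = node l (fun i => fsubst s (c i)).
Proof. by case: l => // p /(_ p). Qed.

(** * Solutions of the system of equations of a graph *)

Definition solves_at (G : pregraph) (s : vert G -> form) (a : vert G) : Prop :=
  equiv (s a) (node (lab a) (fun i => s (nsucc a i))).

Definition solves (G : pregraph) (s : vert G -> form) : Prop :=
  forall a, solves_at s a.

(** [P] may be undecidable, so excluded middle settles whether [e x] enters the conjunction. *)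
Lemma finite_conj (T : finType) (P : T -> Prop) (e : T -> form) :
  exists2 d,
    forall f, (forall x, P x -> GL_form (Imp f (e x))) -> GL_form (Imp f d) &
    forall x, P x -> GL_form (Imp d (e x)).
Proof.
suff [d dI dE]: exists2 d,
    forall f, (forall x, P x -> GL_form (Imp f (e x))) -> GL_form (Imp f d) &
    forall x, x \in enum T -> P x -> GL_form (Imp d (e x)).
  by exists d => // x; apply: dE; rewrite mem_enum.
elim: (enum T) => [|x r [d dI dE]].
  by exists Top => // f _; apply: GL_prop; truth_table.
case: (classic (P x)) => Px; last first.
  by exists d => // y; rewrite inE => /orP[/eqP-> //|]; apply: dE.
exists (And (e x) d) => [f GLf|y].
  by apply: GL_prop2 (GLf x Px) (dI f GLf) _; truth_table.
rewrite inE => /orP[/eqP-> _|r_y Py]; first by apply: GL_prop; truth_table.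
by apply: GL_prop1 (dE y r_y Py) _; truth_table.
Qed.

(* The conjunction [d] of all the equivalences to be proved satisfies
   [h /\ Box d -> d], by induction along the edges leaving unboxed vertices;
   Loeb's rule then applies to [h -> d]. *)
Lemma solution_unique_at (h : form) (G H : pregraph) (s : vert G -> form)
    (t : vert H -> form) (R : vert G -> vert H -> Prop) :
    boxed G -> GL_form (Imp h (Box h)) ->
    (forall a b, R a b -> GL_form (Imp h (Iff (s a) (t b))) \/
       [/\ solves_at s a, solves_at t b, lab a = lab b &
           forall i, i < arity (lab a) -> R (nsucc a i) (nsucc b i)]) ->
  forall a b, R a b -> GL_form (Imp h (Iff (s a) (t b))).
Proof.
move=> boxG h4 R_step.
pose e (x : vert G * vert H) := Iff (s x.1) (t x.2).
have [d dI dE] := finite_conj (fun x => R x.1 x.2) e.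
suff GLhd: GL_form (Imp h d).
  move=> a b Rab.
  by apply: GL_prop2 GLhd (dE (a, b) Rab) _; rewrite /e /=; truth_table.
apply: GL_loeb.
suff hd: GL_form (Imp (And h (Box d)) d).
  (* [h] gives [Box h], so [Box (Imp h d)] gives [Box d]. *)
  by apply: GL_prop3 h4 (GL_K h d) hd _; truth_table.
apply: dI => -[a b]; rewrite /e /=.
move: {2}(rank _ a).+1 (ltnSn (rank (fun x => is_box (lab x)) a)) => n.
elim: n a b => // n IHn a b; rewrite ltnS => le_n Rab.
case: (R_step a b Rab) => [GLh|[sa tb eq_ab Rsucc]].
  by apply: GL_prop1 GLh _; truth_table.
suff: GL_form (Imp (And h (Box d)) (Iff (node (lab a) (fun i => s (nsucc a i)))
                                      (node (lab b) (fun i => t (nsucc b i))))).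
  by move=> GLn; apply: GL_prop3 GLn sa tb _; truth_table.
(* At a box, [Box d] supplies the boxed equivalence; elsewhere the successor has smaller rank. *)
rewrite -eq_ab; apply: GL_node => [box_a|nbox_a i lt_i].
  have R0: R (nsucc a 0) (nsucc b 0) by apply: Rsucc; case: (lab a) box_a.
  apply: GL_prop1 (GL_box (dE (_, _) R0)) _; truth_table.
apply: IHn; last exact: Rsucc.
apply: leq_trans le_n.
exact: (rank_lt (stop := fun x => is_box (lab x)) boxG (edge_nsucc lt_i) nbox_a).
Qed.

(** The case [h := Top]. The first alternative admits boundary pairs whose equivalence is known
    beforehand. *)
Lemma solution_unique (G H : pregraph) (s : vert G -> form)
    (t : vert H -> form) (R : vert G -> vert H -> Prop) :
    boxed G ->
    (forall a b, R a b -> equiv (s a) (t b) \/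
       [/\ solves_at s a, solves_at t b, lab a = lab b &
           forall i, i < arity (lab a) -> R (nsucc a i) (nsucc b i)]) ->
  forall a b, R a b -> equiv (s a) (t b).
Proof.
move=> boxG R_step a b Rab; suff: GL_form (Imp Top (Iff (s a) (t b))).
  by move=> st; apply: GL_prop1 st _; truth_table.
apply: solution_unique_at Rab => // [|x y /R_step [xy|]]; last by right.
  have GLt: GL_form Top by apply: GL_prop; truth_table.
  by apply: GL_prop1 (GL_nec GLt) _; truth_table.
by left; apply: GL_prop1 xy _; truth_table.
Qed.

(* The fixed point theorem of de Jongh and Sambin for the boxed vertex [a]:
   [g] gives it the value Top, and [h] the resulting value of [Box]. *)
Lemma fixed_point (G : pregraph) (a : vert G) (g h : vert G -> form) :
    boxed G -> lab a = Lbox ->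
    g a = Top -> h a = Box (g (nsucc a 0)) ->
    (forall x, x != a -> equiv (g x) (h x) \/ solves_at g x /\ solves_at h x) ->
  solves_at h a.
Proof.
move=> boxG lab_a ga ha gh; set c := g (nsucc a 0) in ha.
(* [Box c] serves as the hypothesis of uniqueness: it implies its own box, and under it the values
   [Top] and [Box c] at [a] agree. *)
have gh_c: GL_form (Imp (Box c) (Iff c (h (nsucc a 0)))).
  apply: (@solution_unique_at (Box c) G G g h eq) => // [|x _ <-].
    exact: GL_4.
  case: (eqVneq x a) => [->|/gh[gh_x|[gx hx]]].
  - by left; rewrite ga ha; apply: GL_prop; truth_table.
  - by left; apply: GL_prop1 gh_x _; truth_table.
  - by right; split=> // i _; left.
rewrite /solves_at lab_a /= ha; set c' := h _ in gh_c *.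
have box_gh_c: GL_form (Imp (Box c) (Iff (Box c) (Box c'))).
  apply: GL_box_iff; apply: GL_prop2 (GL_4 c) (GL_box gh_c) _; truth_table.
(* By Loeb's rule: [Box c'] gives [Box (Box c')], the Loeb hypothesis turns this into [Box (Box c)],
   and [gh_c] taken under a box then leads from [Box c'] to [Box c]. *)
have c'_c: GL_form (Imp (Box c') (Box c)).
  apply: GL_loeb.
  have K := GL_K (Box c') (Box c).
  have c'c: GL_form (Imp (Box (Box c)) (Imp (Box c') (Box c))).
    apply: GL_box2; apply: GL_prop1 gh_c _; truth_table.
  apply: GL_prop3 K (GL_4 c') c'c _; truth_table.
by apply: GL_prop2 box_gh_c c'_c _; truth_table.
Qed.

(** With every boxed vertex prescribed, rank decreases along the remaining edges, so iterating the
    equations from [v] becomes stationary. *)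
Lemma unboxed_solution_exists (G : pregraph) (B : pred (vert G))
    (v : vert G -> form) :
    boxed G -> (forall a, is_box (lab a) -> B a) ->
  exists s, forall a, if B a then s a = v a else solves_at s a.
Proof.
move=> boxG boxB.
pose step s (a : vert G) := if B a then v a else
  node (lab a) (fun i => s (nsucc a i)) : form.
have stable n a : rank (fun x => is_box (lab x)) a < n ->
    iter n.+1 step v a = iter n step v a.
  elim: n a => // n IHn a; rewrite ltnS => le_n.
  rewrite [LHS]/= [RHS]/= [LHS]/step [RHS]/step; case: ifPn => // nBa.
  apply: eq_node => i lt_i; apply: IHn; apply: leq_trans le_n.
  apply: (rank_lt (stop := fun x => is_box (lab x)) boxG (edge_nsucc lt_i)).
  by apply: contra nBa; apply: boxB.
(* This bound exceeds every rank, so all vertices are stable after [n] rounds. *)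
pose n := (\max_(a : vert G) rank (fun x => is_box (lab x)) a).+1.
exists (iter n step v) => a.
have := stable n a; rewrite ltnS leq_bigmax => /(_ isT) st.
case: ifPn => [Ba|nBa]; first by rewrite /= /step Ba.
by rewrite /solves_at -{1}st /= {1}/step (negbTE nBa); apply: equiv_refl.
Qed.

(** Induction on the number of boxed vertices outside [B]. One of them, [a], is first prescribed as
    [Top], giving [g], then as [Box] of the value of [g] at its successor, giving [h]; by
    [fixed_point], [h] also solves the equation at [a]. *)
Lemma solution_exists (G : pregraph) (B : pred (vert G)) (v : vert G -> form) :
    boxed G -> exists s, forall a, if B a then s a = v a else solves_at s a.
Proof.
move=> boxG; pose boxes (C : pred (vert G)) := [pred a | is_box (lab a) && ~~ C a].
move: {2}#|boxes B|.+1 (ltnSn #|boxes B|) => n.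
elim: n B v => // n IHn B v; rewrite ltnS => le_n.
case: (pickP (boxes B)) => [a box_a|no_box]; last first.
  apply: unboxed_solution_exists => // a box_a.
  by have:= no_box a; rewrite /= box_a /= => /negbFE.
pose C := [pred x | (x == a) || B x].
have lt_C: #|boxes C| < n.
  apply: leq_trans le_n; rewrite [X in _ < X](cardD1 a) [_ \in _]box_a ltnS.
  apply/subset_leq_card/subsetP => x.
  by rewrite !inE negb_or => /and3P [-> -> ->].
have [/= box_a1 nBa] := andP box_a.
have lab_a: lab a = Lbox by case: (lab a) box_a1.
have [g g_sol] := IHn C (fun x => if x == a then Top else v x) lt_C.
have [h h_sol] := IHn C (fun x => if x == a then Box (g (nsucc a 0)) else v x) lt_C.
have:= g_sol a; have:= h_sol a; rewrite /= eqxx /= => ha ga.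
exists h => x; case: (eqVneq x a) => [->|ne_xa]; last first.
  by have:= h_sol x; rewrite /= (negbTE ne_xa).
rewrite (negbTE nBa); apply: fixed_point ga ha _ => // y ne_ya.
have:= g_sol y; have:= h_sol y; rewrite /= (negbTE ne_ya) /=.
(* On [B] both [g] and [h] take the value [v y]; off it both solve the equation. *)
by case: (B y) => [-> ->|]; [left; apply: equiv_refl|right].
Qed.

Lemma solves_exists (G : pregraph) : boxed G -> exists s : vert G -> form, solves s.
Proof.
by move=> boxG; have [s] := solution_exists pred0 (fun=> Bot) boxG; exists s.
Qed.

(** * Graph homomorphisms and bisimilarity at vertices *)

Definition hom (G H : pregraph) (h : vert G -> vert H) : Prop :=
  forall x, lab (h x) = lab x /\
    forall i, i < arity (lab x) -> nsucc (h x) i = h (nsucc x i).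

Lemma nsucc_map (G : pregraph) (x : vert G) (T : Type) (y0 : T)
    (h : vert G -> T) (i : nat) :
  i < arity (lab x) -> nth y0 [seq h y | y <- succs x] i = h (nsucc x i).
Proof. by move=> lt_i; apply: nth_map; rewrite size_succs. Qed.

Lemma hom_op_in (l : label) (args : 'I_(arity l) -> cform) (i : 'I_(arity l)) :
  @hom (args i) (cop args) (@op_in _ args i).
Proof. by move=> x; split=> // j lt_j; apply: nsucc_map. Qed.

Lemma hom_gen (G : pregraph) (a : vert G) : @hom (gen_pre a) G val.
Proof.
move=> x; split=> // i lt_i; rewrite {2}/nsucc nsucc_map // val_insubd ifT //.
apply: connect_trans (valP x) _; apply: connect1; exact: edge_nsucc.
Qed.

Lemma hom_sub_in (phi : cform) (k : nat) (q : 'I_k -> nat) (chi : 'I_k -> cform)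
    (i : 'I_k) :
  @hom (chi i) (sub_pre phi q chi) (@sub_in phi k chi i).
Proof. by move=> x; split=> // j lt_j; apply: nsucc_map. Qed.

Lemma nsucc_root_cop (l : label) (args : 'I_(arity l) -> cform)
    (i : 'I_(arity l)) :
  nsucc (root (cop args)) i = op_in (root (args i)).
Proof.
by rewrite /nsucc /= (nth_map i) ?size_enum_ord // nth_ord_enum.
Qed.

(** Used to restrict a solution of a compound graph to its constituents. *)
Lemma solves_hom (G H : pregraph) (h : vert G -> vert H) (s : vert H -> form) :
  hom h -> solves s -> solves (s \o h).
Proof.
move=> hom_h sol_s x; have [lab_h succ_h] := hom_h x.
rewrite /solves_at /= (eq_node (d := fun i => s (nsucc (h x) i))).
  by rewrite -lab_h; apply: sol_s.
by move=> i lt_i /=; rewrite succ_h.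
Qed.

Definition bisimilar_at (G H : pregraph) (a : vert G) (b : vert H) : Prop :=
  exists2 R : vert G -> vert H -> Prop, bisimulation R & R a b.

Lemma bisimilarE (G H : pregraph) :
  bisimilar G H <-> bisimilar_at (root G) (root H).
Proof. by split=> [[R []]|[R]]; exists R. Qed.

Lemma bisimilar_refl (G : pregraph) : bisimilar G G.
Proof. by exists eq; split=> // a _ <-. Qed.

Lemma bisimulation_bisimilar_at (G H : pregraph) :
  bisimulation (@bisimilar_at G H).
Proof.
move=> a b [R bisR /bisR [eq_ab Rsucc]].
by split=> // i lt_i; exists R => //; apply: Rsucc.
Qed.

Lemma bisimilar_at_hom (G H K : pregraph) (h : vert H -> vert K)
    (a : vert G) (b : vert H) :
  hom h -> bisimilar_at a (h b) <-> bisimilar_at a b.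
Proof.
move=> hom_h; split=> [[R bisR Rab]|[R bisR Rab]].
  exists (fun x y => R x (h y)) => // x y Rxy.
  have [lab_h succ_h] := hom_h y; have [eq_xy Rsucc] := bisR _ _ Rxy.
  rewrite eq_xy; split=> // i lt_i; rewrite -succ_h -?lab_h //.
  by apply: Rsucc; rewrite eq_xy.
exists (fun x z => exists2 y, R x y & z = h y) => [x z [y Rxy ->]|]; last by exists b.
have [lab_h succ_h] := hom_h y; have [eq_xy Rsucc] := bisR _ _ Rxy.
rewrite lab_h; split=> // i lt_i; exists (nsucc y i); first exact: Rsucc.
by rewrite succ_h // -eq_xy.
Qed.

(** Unfolds bisimilarity by one level, which opens embedded formulas to induction on syntax. *)
Lemma bisimilar_at_cop (l : label) (args : 'I_(arity l) -> cform)
    (G : pregraph) (a : vert G) :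
  bisimilar_at (root (cop args)) a <->
  lab a = l /\ forall i : 'I_(arity l), bisimilar_at (root (args i)) (nsucc a i).
Proof.
split=> [/bisimulation_bisimilar_at [<- bis_succ]|[lab_a bis_succ]].
  split=> // i; have [R bisR] := bis_succ i (ltn_ord i).
  rewrite nsucc_root_cop => Ri; exists (fun x y => R (op_in x) y) => // x y Rxy.
  have [eq_xy Rsucc] := bisR _ _ Rxy; split=> // j lt_j.
  by have [_ <-] := hom_op_in x; [apply: Rsucc|].
pose R (u : vert (cop args)) y := match u with
  | Some (existT i x) => bisimilar_at x y | None => y = a end.
exists R => // -[[i x]|] y /=.
  case/bisimulation_bisimilar_at=> eq_xy bis_xy; split=> // j lt_j.
  by have [_ ->] := hom_op_in x; [apply: bis_xy|].
move=> ->; split=> // i lt_i.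
by rewrite (nsucc_root_cop args (Ordinal lt_i)); apply: bis_succ (Ordinal lt_i).
Qed.

Lemma bisimilar_cop (l : label) (args args' : 'I_(arity l) -> cform) :
  (forall i, bisimilar (args i) (args' i)) -> bisimilar (cop args) (cop args').
Proof.
move=> bis; apply/bisimilarE/bisimilar_at_cop; split=> // i.
rewrite nsucc_root_cop; apply/(bisimilar_at_hom _ _ (hom_op_in (i := i))).
exact/bisimilarE.
Qed.

Lemma bisimilar_equiv (G H : pregraph) (s : vert G -> form) (t : vert H -> form)
    (a : vert G) (b : vert H) :
  boxed G -> solves s -> solves t -> bisimilar_at a b -> equiv (s a) (t b).
Proof.
move=> boxG sol_s sol_t; apply: solution_unique a b => // a b.
by case/bisimulation_bisimilar_at=> eq_ab bis_ab; right.
Qed.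

Lemma embed_node (l : label) (c : nat -> form) :
  embed (node l c) = @cop l (fun i => embed (c i)).
Proof.
case: l => [||p|||||] /=; congr cop; apply: functional_extensionality;
  by case=> -[|[|i]].
Qed.

(** * Correctness of js *)

(** [R] is a bisimulation except at the root of [phi], where it leads to the copy of [psi]. The root
    of [cut_subst phi psi] still plays the uncut root, hence its separate clauses. *)
Lemma cut_subst_root (phi psi : cform) :
    on_cycle (root phi) ->
  exists R : vert (cut_subst phi psi) -> vert phi -> Prop,
  [/\ lab (root (cut_subst phi psi)) = lab (root phi),
      forall i, i < arity (lab (root phi)) ->
        R (nsucc (root (cut_subst phi psi)) i) (nsucc (root phi) i) &
      forall u x, R u x ->
        if x == root phi then bisimilar_at (root psi) u else
        lab u = lab x /\ forall i, i < arity (lab x) -> R (nsucc u i) (nsucc x i)].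
Proof.
move=> cyc_r; have := freshP phi; rewrite /cut_subst /cut.
move: (fresh phi) => p /existsPn fresh_p.
case: Sumbool.sumbool_of_bool => [cyc_r'|]; last by rewrite cyc_r.
set chi := CForm _ _; set G := csubst1 chi p psi.
have hom_val: @hom G _ val by apply: hom_gen.
(* As [p] is fresh, only the vertex [None] added by the cut is redirected. *)
have dirS (x : vert phi) :
    sub_dir (fun _ : 'I_1 => p) (fun=> psi) (Some x : vert chi) = inl (Some x).
  rewrite /sub_dir; case: pickP => //= i; by rewrite (negbTE (fresh_p x)).
have dirN : sub_dir (fun _ : 'I_1 => p) (fun=> psi) (None : vert chi) =
     sub_in chi (root psi) (i := ord0) .
  rewrite /sub_dir; case: pickP => [i _|/(_ ord0)]; last by rewrite /= eqxx.
  by rewrite (ord1 i).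
(* [u] is where an edge into [x] ends after cutting and substituting. *)
pose R (u : vert G) (x : vert phi) := val u = 
  sub_dir (fun=> p) (fun=> psi) (cut_dir x : vert chi).
have R_succ (u : vert G) x i : val u = inl (Some x) -> i < arity (lab x) ->
    R (nsucc u i) (nsucc x i).
  move=> def_u lt_i; rewrite /R; have [lab_u succ_u] := hom_val u.
  rewrite -succ_u -?lab_u def_u // /nsucc /= -map_comp.
  exact: nsucc_map.
have val_root: val (root G) = inl (Some (root phi)).
  by rewrite /= dirS.
exists R; split=> [||u x].
- by have [<- _] := hom_val (root G); rewrite val_root.
- by move=> i lt_i; apply: R_succ.
rewrite /R /cut_dir; case: eqP => [_|_] def_u; last first.
  rewrite dirS in def_u; have [<- _] := hom_val u; rewrite {1}def_u.
  by split=> // i; apply: R_succ.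
apply: (proj1 (bisimilar_at_hom _ u hom_val)); rewrite def_u dirN.
apply: (proj2 (bisimilar_at_hom _ _ (@hom_sub_in chi 1 (fun=> p) (fun=> psi) ord0))).
exact/bisimilarE/bisimilar_refl.
Qed.

(** The choice is extended by [Bot] beyond [n], to fit the children of [node]. *)
Lemma fin_choice (n : nat) (P : 'I_n -> form -> Prop) :
  (forall i, exists f, P i f) -> exists c : nat -> form, forall i : 'I_n, P i (c i).
Proof.
case/fin_all_exists=> f Pf; exists (fun m => if insub m is Some i then f i else Bot).
by move=> i; rewrite valK.
Qed.

(* In the cut case, the value of [cut_subst (gen a) ctop] at its root is
   [Box (g b)], where [b] is the successor of [a] and [g] is a solution with
   the value of [a] set to [Top]: the fixed point at [a]. *)
Lemma js_star_solution (phi : cform) (a : vert phi) :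
  exists2 f, bisimilar (embed f) (js_star a) &
    forall s : vert phi -> form, solves s -> equiv f (s a).
Proof.
pose P (x : point) := exists2 f, bisimilar (embed f) (js_star (projT2 x)) &
  forall s : vert (projT1 x) -> form, solves s -> equiv f (s (projT2 x)).
suff: P (at_ a) by [].
elim: {phi a}(at_ a) / (js_call_wf (at_ a)) => -[phi a] _ IH; rewrite /P /= js_starE.
rewrite -/(cyc_box a); case: ifPn => [cyc_a|ncyc_a]; last first.
  have /fin_choice [c Pc] : forall i : 'I_(arity (lab a)), exists f,
      bisimilar (embed f) (js_star (nsucc a i)) /\
      forall s : vert phi -> form, solves s -> equiv f (s (nsucc a i)).
    move=> i; have [f bis_f sol_f] := IH _ (js_call_succ ncyc_a (ltn_ord i)).
    by exists f.
  exists (node (lab a) c) => [|s sol_s].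
    by rewrite embed_node; apply: bisimilar_cop => i; have [] := Pc i.
  apply: equiv_trans (equiv_sym (sol_s a)); apply: equiv_node => i lt_i.
  by have [_] := Pc (Ordinal lt_i); apply.
have [f bis_f sol_f] := IH _ (js_call_cut cyc_a); exists f => // s sol_s.
have [box_a cyc] := andP cyc_a.
have [R [lab_r R_root R_step]] := @cut_subst_root (gen a) ctop (on_cycle_gen cyc).
move: sol_f {IH bis_f cyc_a} => /=; set psi := cut_subst _ _ in R lab_r R_root R_step *.
have [s' sol_s'] := solves_exists (@cform_boxed psi).
move=> /(_ _ sol_s') eq_f.
pose b := root (gen a); have lab_b : lab b = Lbox by rewrite /=; case: (lab a) box_a.
have boxG := @cform_boxed (gen a).
have [g g_sol] := solution_exists (pred1 b) (fun=> Top) boxG.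
have [h h_sol] := solution_exists (pred1 b) (fun=> Box (g (nsucc b 0))) boxG.
have:= g_sol b; have:= h_sol b; rewrite /= !eqxx => hb gb.
(* Only [b] was prescribed, and [fixed_point] gives its equation as well. *)
have sol_h: solves h.
  move=> x; case: (eqVneq x b) => [->|ne_xb].
    apply: fixed_point gb hb _ => // y ne_yb; right.
    by have:= g_sol y; have:= h_sol y; rewrite /= (negbTE ne_yb).
  by have:= h_sol x; rewrite /= (negbTE ne_xb).
apply: equiv_trans eq_f _.
have s'_root: equiv (s' (root psi)) (Box (s' (nsucc (root psi) 0))).
  by have:= sol_s' (root psi); rewrite /solves_at lab_r lab_b.
apply: equiv_trans s'_root _.
(* Restricted to the subgraph generated by [a], [s] is a solution there, just as [h] is. *)
have s_h: equiv (h b) (s a).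
  rewrite -[s a]/((s \o val) b).
  apply: (@bisimilar_equiv (gen a) (gen a)) => //.
    by apply: solves_hom sol_s; apply: hom_gen.
  exact/bisimilarE/bisimilar_refl.
apply: equiv_trans s_h; rewrite hb.
suff: equiv (s' (nsucc (root psi) 0)) (g (nsucc b 0)).
  move=> s'g.
  exact: (@equiv_node Lbox (fun=> s' _) (fun=> g _) (fun _ _ => s'g)).
(* Boundary pairs have [x = b]: then [u] is bisimilar to the root of [ctop], so both values are
   equivalent to [Top]. *)
apply: (solution_unique (R := R)) => [|u x /R_step|]; first exact: cform_boxed.
  have:= g_sol x; rewrite /=; case: eqP => [_ ->|_ gx [eq_ux Rsucc]].
    case/bisimulation_bisimilar_at=> lab_u _.
    by left; have:= sol_s' u; rewrite /solves_at -lab_u.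
  by right; rewrite eq_ux.
by apply: R_root; rewrite lab_b.
Qed.

(** * Translations of cyclic formulas *)

(** By uniqueness of solutions, this determines [f] up to GL-equivalence, whatever solution is
    chosen. *)
Definition translates (phi : cform) (f : form) : Prop :=
  exists2 s : vert phi -> form, solves s & equiv f (s (root phi)).

Lemma translates_exists (phi : cform) : exists f, translates phi f.
Proof.
have [s sol_s] := solves_exists (@cform_boxed phi).
by exists (s (root phi)), s => //; apply: equiv_refl.
Qed.

Lemma translates_bisimilar (phi psi : cform) (f g : form) :
  bisimilar phi psi -> translates phi f -> translates psi g -> equiv f g.
Proof.
move/bisimilarE=> bis [s sol_s fs] [t sol_t gt].
apply: equiv_trans fs _; apply: equiv_trans (equiv_sym gt).
exact: bisimilar_equiv (@cform_boxed phi) _ _ bis.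
Qed.

Lemma translates_unique (phi : cform) (f g : form) :
  translates phi f -> translates phi g -> equiv f g.
Proof. exact: translates_bisimilar (bisimilar_refl phi). Qed.

(** Reduces GL-statements about [js] to statements about solutions. *)
Lemma translates_js (phi : cform) :
  exists2 f, bisimilar (embed f) (js phi) & translates phi f.
Proof.
have [f bis_f sol_f] := js_star_solution (root phi); exists f => //.
have [s sol_s] := solves_exists (@cform_boxed phi).
by exists s => //; apply: sol_f.
Qed.

Lemma translates_cop (l : label) (args : 'I_(arity l) -> cform)
    (c : nat -> form) :
  (forall i : 'I_(arity l), translates (args i) (c i)) ->
  translates (cop args) (node l c).
Proof.
move=> tr_c; have [s sol_s] := solves_exists (@cform_boxed (cop args)).
exists s => //; apply: equiv_trans (equiv_sym (sol_s _)).
apply: equiv_node => i lt_i; pose j := Ordinal lt_i.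
rewrite -[i]/(nat_of_ord j) nsucc_root_cop.
apply: translates_unique (tr_c j) _; exists (s \o @op_in _ args j).
  by apply: solves_hom sol_s; apply: hom_op_in.
exact: equiv_refl.
Qed.

Lemma translates_cimp (phi psi : cform) (f g : form) :
  translates phi f -> translates psi g -> translates (cimp phi psi) (Imp f g).
Proof.
move=> tr_f tr_g.
by apply: (@translates_cop Limp _ (nth Bot [:: f; g])) => -[[|[]]].
Qed.

Lemma translates_cand (phi psi : cform) (f g : form) :
  translates phi f -> translates psi g -> translates (cand phi psi) (And f g).
Proof.
move=> tr_f tr_g.
by apply: (@translates_cop Land _ (nth Bot [:: f; g])) => -[[|[]]].
Qed.

Lemma translates_cbox (phi : cform) (f : form) :
  translates phi f -> translates (cbox phi) (Box f).
Proof. by move=> tr_f; apply: (@translates_cop Lbox _ (fun=> f)). Qed.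

Lemma translates_embed (f : form) : translates (embed f) f.
Proof.
elim/node_ind: f => [p|l c _ IHc].
  by apply: (@translates_cop (Lvar p) _ (fun=> Bot)) => -[].
by rewrite embed_node; apply: translates_cop => i; apply: IHc.
Qed.

(** The same [pick] as in [sub_dir], so both select the same index for a variable. *)
Definition subst_of (k : nat) (q : 'I_k -> nat) (c : nat -> form) (p : nat) : form :=
  if [pick i | is_var (q i) (Lvar p)] is Some i then c i else Var p.

Lemma sub_dir_nvar (phi : cform) (k : nat) (q : 'I_k -> nat)
    (chi : 'I_k -> cform) (a : vert phi) :
  (forall p, lab a <> Lvar p) -> sub_dir q chi a = inl a.
Proof.
move=> nvar; rewrite /sub_dir; case: pickP => // i.
by case: (lab a) nvar => // p /(_ p).
Qed.

Lemma nsucc_sub_inl (phi : cform) (k : nat) (q : 'I_k -> nat)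
    (chi : 'I_k -> cform) (a : vert phi) (i : nat) : i < arity (lab a) ->
  nsucc (inl a : vert (sub_pre phi q chi)) i = sub_dir q chi (nsucc a i).
Proof. exact: nsucc_map. Qed.

(** A solution of the substituted graph is compared, along [sub_dir], with the substitution applied
    to a solution of [phi]. *)
Lemma translates_csubst (phi : cform) (k : nat) (q : 'I_k -> nat)
    (chi : 'I_k -> cform) (f : form) (c : nat -> form) :
    translates phi f -> (forall i : 'I_k, translates (chi i) (c i)) ->
  translates (csubst phi q chi) (fsubst (subst_of q c) f).
Proof.
move=> [t sol_t f_t] tr_c; set G := sub_pre phi q chi.
have boxG : boxed G by apply: sub_boxed.
have [s sol_s] := solves_exists boxG.
exists (s \o val); first by apply: solves_hom sol_s; apply: hom_gen.
apply: equiv_trans (equiv_subst _ f_t) _; apply: equiv_sym.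
apply: (@solution_unique G phi s (fun x => fsubst (subst_of q c) (t x))
  (fun u x => u = sub_dir q chi x) boxG _ (root G) (root phi)) => // {f_t f}.
move=> _ x ->.
(* Variable occurrences are boundary pairs, settled by uniqueness inside [chi i]; at other vertices
   substitution commutes with [node]. *)
case: (boolP (if lab x is Lvar _ then true else false)) => [var_x|nvar_x].
  left; case lab_x: (lab x) var_x => [||p|||||] // _.
  have t_x: equiv (fsubst (subst_of q c) (t x)) (subst_of q c p).
    by have:= equiv_subst (subst_of q c) (sol_t x); rewrite lab_x.
  apply: equiv_trans (equiv_sym t_x).
  rewrite /subst_of /sub_dir lab_x; case: pickP => [i _|no_q].
    apply: (@translates_unique (chi i)) => //.
    exists (s \o @sub_in phi k chi i); last exact: equiv_refl.
    by apply: solves_hom sol_s; apply: hom_sub_in.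
  by have:= sol_s (inl x); rewrite /solves_at /= lab_x.
have {}nvar_x p : lab x <> Lvar p by move=> lab_x; rewrite lab_x in nvar_x.
right; rewrite sub_dir_nvar //; split=> // [|i lt_i]; last exact: nsucc_sub_inl.
rewrite /solves_at -(@fsubst_node _ _ (fun i => t (nsucc x i))) //.
exact: equiv_subst (sol_t x).
Qed.

Lemma bisimilar_fsubst (phi : cform) (k : nat) (q : 'I_k -> nat)
    (chi : 'I_k -> cform) (f : form) (c : nat -> form) :
    bisimilar (embed f) phi ->
    (forall i : 'I_k, bisimilar (embed (c i)) (chi i)) ->
  bisimilar (embed (fsubst (subst_of q c) f)) (csubst phi q chi).
Proof.
move=> /bisimilarE bis_f bis_c; apply/bisimilarE.
set G := sub_pre phi q chi.
apply: (proj1 (bisimilar_at_hom _ _ (@hom_gen G (root G)))).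
(* The induction on [f] needs an arbitrary vertex in place of the root. *)
rewrite [val _]/=; move: (root phi) bis_f => x.
elim/node_ind: f x => [p|l d nvar IHd] x.
  rewrite -[embed (Var p)]/(cvar p).
  case/bisimilar_at_cop=> lab_x _ /=.
  rewrite /sub_dir /subst_of lab_x; case: pickP => [i _|_].
    apply: (proj2 (bisimilar_at_hom _ _ (@hom_sub_in phi k q chi i))).
    exact/bisimilarE.
  by apply/bisimilar_at_cop; split=> // -[].
rewrite fsubst_node // !embed_node => /bisimilar_at_cop [lab_x bis_d].
rewrite sub_dir_nvar; last by rewrite lab_x.
apply/bisimilar_at_cop; split=> // i.
rewrite nsucc_sub_inl ?lab_x //; exact: IHd (bis_d i).
Qed.

(** * Commutation of [js] with connectives and substitution, and soundness of [GLo] *)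

Lemma GL_ciff (phi psi : cform) (f g : form) :
    bisimilar (embed f) phi -> bisimilar (embed g) psi -> equiv f g ->
  GL (ciff phi psi).
Proof.
move=> bis_f bis_g fg; exists (Iff f g) => //.
by apply: bisimilar_cop => i; rewrite /pair_arg; case: ifP => _;
  apply: bisimilar_cop => j; rewrite /pair_arg; case: ifP.
Qed.

Lemma js_cop (l : label) (args : 'I_(arity l) -> cform) :
  GL (ciff (js (cop args)) (@cop l (fun i => js (args i)))).
Proof.
have [f bis_f tr_f] := translates_js (cop args).
have /fin_choice [c Pc] : forall i : 'I_(arity l), exists g,
    bisimilar (embed g) (js (args i)) /\ translates (args i) g.
  by move=> i; have [g ? ?] := translates_js (args i); exists g.
apply: GL_ciff bis_f _ (translates_unique tr_f (translates_cop (c := c) _)) => [|i].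
  by rewrite embed_node; apply: bisimilar_cop => i; have [] := Pc i.
by have [] := Pc i.
Qed.

(** Both sides are represented by modal formulas translating [csubst phi q chi], hence equivalent
    ones. *)
Lemma js_csubst (phi : cform) (k : nat) (q : 'I_k -> nat) (chi : 'I_k -> cform) :
  GL (ciff (js (csubst phi q chi)) (csubst (js phi) q (fun i => js (chi i)))).
Proof.
have [f bis_f tr_f] := translates_js (csubst phi q chi).
have [g bis_g tr_g] := translates_js phi.
have /fin_choice [c Pc] : forall i : 'I_k, exists h,
    bisimilar (embed h) (js (chi i)) /\ translates (chi i) h.
  by move=> i; have [h ? ?] := translates_js (chi i); exists h.
apply: GL_ciff bis_f (bisimilar_fsubst (c := c) q bis_g _) _ => [i|].
  by have [] := Pc i.
apply: translates_unique tr_f (translates_csubst q tr_g _) => i.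
by have [] := Pc i.
Qed.

(** Induction on derivations. Quantifying over all translations lets the rules use translations of
    the premises built from those of their parts. *)
Lemma GLo_translates (phi : cform) :
  GLo phi -> forall f, translates phi f -> GL_form f.
Proof.
have by_one psi g : translates psi g -> GL_form g ->
    forall f, translates psi f -> GL_form f.
  by move=> tr_g GLg f tr_f; apply: equiv_GL (translates_unique tr_g tr_f) GLg.
elim=> {phi} [_ [phi ->]|t k q chi phi taut_t _ bis|phi psi|phi psi bis
             |phi psi _ IHimp _ IHphi|phi _ IH|phi _ IH].
- have [f tr_f] := translates_exists phi.
  apply: by_one (GL_4 f); apply: translates_cimp; last apply: translates_cbox;
    exact: translates_cbox.
- have /fin_choice [c tr_c] := fun i => translates_exists (chi i).
  (* Bisimilar formulas have equivalent translations, so closing tautology instances under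
     bisimilarity is harmless. *)
  move=> f tr_f; apply: equiv_GL (GL_taut (subst_of q c) taut_t).
  apply: translates_bisimilar bis _ tr_f.
  exact: translates_csubst (translates_embed t) tr_c.
- have [f tr_f] := translates_exists phi; have [g tr_g] := translates_exists psi.
  apply: by_one (GL_K f g); apply: translates_cimp.
    by apply/translates_cbox/translates_cimp.
  by apply: translates_cimp; apply: translates_cbox.
- have [f tr_f] := translates_exists phi; have [g tr_g] := translates_exists psi.
  apply: by_one (translates_bisimilar bis tr_f tr_g).
  by apply: translates_cand; apply: translates_cimp.
- have [f tr_f] := translates_exists phi => g tr_g.
  by apply: GL_mp (IHimp _ (translates_cimp tr_f tr_g)) (IHphi _ tr_f).
- have [f tr_f] := translates_exists phi.
  exact: (by_one _ _ (translates_cbox tr_f) (GL_nec (IH f tr_f))).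
- move=> f tr_f; apply: GL_loeb.
  exact: IH (translates_cimp (translates_cbox tr_f) tr_f).
Qed.

(** * Acyclicity of [js], its values at constants and variables, and the theorem *)

Lemma acyclic_rank (G : pregraph) (f : vert G -> nat) :
  (forall a b, edge G a b -> f b < f a) -> acyclic G.
Proof.
move=> f_lt c cyc_c.
have := rank_boxed (stop := pred0) (f := f) (fun a b e_ab _ => f_lt a b e_ab) cyc_c.
by rewrite has_pred0.
Qed.

Lemma cop_acyclic (l : label) (args : 'I_(arity l) -> cform) :
  (forall i, acyclic (args i)) -> acyclic (cop args).
Proof.
move=> acyc; pose r (i : 'I_(arity l)) := rank (G := args i) pred0.
(* The new root is ranked just above the roots of all arguments. *)
pose f (u : vert (cop args)) := if u is Some (existT i x) then r i x
  else (\max_(i < arity l) r i (root (args i))).+1.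
apply: (acyclic_rank (f := f)) => -[[i x]|] _ /mapP [y e_xy ->] /=.
  by apply: rank_lt => // c /acyc.
by rewrite ltnS (@leq_bigmax _ (fun i => r i (root (args i)))).
Qed.

Lemma js_star_acyclic (phi : cform) (a : vert phi) : acyclic (js_star a).
Proof.
suff: forall x : point, acyclic (js_star (projT2 x)) by move/(_ (at_ a)).
elim/(well_founded_ind js_call_wf) => -[psi b] IH; rewrite /= js_starE.
rewrite -/(cyc_box b); case: ifPn => [cyc_b|ncyc_b].
  exact: IH (js_call_cut cyc_b).
by apply: cop_acyclic => i; apply: IH (js_call_succ ncyc_b (ltn_ord i)).
Qed.

(** A nullary label is no box, so [js] unfolds to [cop]; argument families over an empty index type
    coincide, whence a genuine equality. *)
Lemma js_const (l : label) (args args' : 'I_(arity l) -> cform) :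
  arity l = 0 -> js (cop args) = cop args'.
Proof.
move=> arity0; have noI (i : 'I_(arity l)) : False by case: i; rewrite arity0.
rewrite /js js_starE; case: ifP => [/andP [box_l _]|_].
  have box_arity: is_box l -> arity l <> 0 by case: (l).
  by case: (box_arity box_l).
by rewrite /=; congr cop; apply: functional_extensionality => i; case: (noI i).
Qed.

Lemma js_pair (phi psi : cform) :
  (fun i => js (pair_arg phi psi i)) = pair_arg (js phi) (js psi).
Proof.
by apply: functional_extensionality => i; rewrite /pair_arg; case: ifP.
Qed.

Theorem theorem4p12 :
  (* (i) *)
  (forall phi : cform, acyclic (js phi)) /\
  (* (ii) *)
  ((forall p : nat, js (cvar p) = cvar p) /\
   (forall phi : cform, GL (ciff (js (cneg phi)) (cneg (js phi)))) /\
   (forall phi : cform, GL (ciff (js (cbox phi)) (cbox (js phi)))) /\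
   (forall phi psi : cform,
      GL (ciff (js (cand phi psi)) (cand (js phi) (js psi)))) /\
   (forall phi psi : cform,
      GL (ciff (js (cor phi psi)) (cor (js phi) (js psi)))) /\
   (forall phi psi : cform,
      GL (ciff (js (cimp phi psi)) (cimp (js phi) (js psi)))) /\
   js ctop = ctop /\
   js cbot = cbot) /\
  (* (iii) *)
  (forall (phi : cform) (k : nat) (q : 'I_k -> nat) (chi : 'I_k -> cform),
     injective q ->
     GL (ciff (js (csubst phi q chi))
              (csubst (js phi) q (fun i => js (chi i))))) /\
  (* (iv) *)
  (forall phi : cform, GLo phi -> GL (js phi)).
Proof.
split=> [phi|]; first exact: js_star_acyclic.
split.
  split=> [p|]; first exact: js_const.
  split=> [phi|]; first exact: js_cop.
  split=> [phi|]; first exact: js_cop.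
  do 3!(split=> [phi psi|];
        first by rewrite /cand /cor /cimp -js_pair; apply: js_cop).
  by split; apply: js_const.
split=> [phi k q chi _|phi GLo_phi]; first exact: js_csubst.
have [f bis_f tr_f] := translates_js phi.
by exists f => //; apply: GLo_translates tr_f.
Qed.
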